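(* Let $B:\mathbb{R}^{\hat n}\to\mathbb{R}^{\hat m}$ and $G:\mathbb{R}^{\hat n}\to\mathbb{R}^{\hat l}$ be twice continuously differentiable, let $D\subseteq\mathbb{R}^{\hat l}$ be a polyhedral set (finite union of convex polyhedral sets), $\Gamma:=\{z\mid G(z)\in D\}$ and $\Omega:=\{B(z)\mid z\in\Gamma\}$. Let $\bar\omega\in\Omega$ and $\bar z\in\Sigma_{\bar\omega}$ be such that $\nabla B(\bar z)w=0$, $w\in L_{\bar z}$ imply $w=0$. Consider $\gamma_B>0$ and an open neighborhood $\widetilde W$ of $\bar z$ such that $$\min\{\|\nabla B(\bar z)w\|\mid w\in L_{\bar z},\|w\|=1\}>\gamma_B,$$ $$\|\nabla B(z)w\|\ge\gamma_B\|w\|\ \ \forall z\in\Gamma\cap\widetilde W,\ w\in L_z,\qquad \|B(z_1)-B(z_2)\|\ge\gamma_B\|z_1-z_2\|\ \ \forall z_1,z_2\in\Gamma\cap\widetilde W.$$ Consider open neighborhoods $\mathcal O$ of $\bar\omega$ and $W\subseteq\widetilde W$ of $\bar z$ and a bijective mapping $\hat z:\Omega\cap\mathcal O\to\Gamma\cap W$ which is Lipschitzian on $\Omega\cap\mathcal O$ with constant $1/\gamma_B$ and satisfies $\big(B^{-1}(\omega)\cap\Gamma\big)\cap W=\{\hat z(\omega)\}$ for all $\omega\in\Omega\cap\mathcal O$. Then for every $\omega\in\Omega\cap\mathcal O$, $\eta\in T_\Omega(\omega)$ and $\omega^*\in\mathbb{R}^{\hat m}$, with $z:=\hat z(\omega)$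 and $w:=\hat z'(\omega;\eta)$, we have $$\mathrm{d}^2\delta_\Omega(\omega;\omega^* )(\eta)=\mathrm{d}^2\delta_\Gamma(z;\nabla B(z)^T\omega^* )(w)-\langle\omega^*,\nabla^2B(z)(w,w)\rangle,$$ $$\sigma_{T^2_\Omega(\omega;\eta)}(\omega^* )=\sigma_{T^2_\Gamma(z;w)}(\nabla B(z)^T\omega^* )+\langle\omega^*,\nabla^2B(z)(w,w)\rangle,$$ $$\hat\sigma_{T^2_\Omega(\omega;\eta)}(\omega^* )=\hat\sigma_{T^2_\Gamma(z;w)}(\nabla B(z)^T\omega^* )+\langle\omega^*,\nabla^2B(z)(w,w)\rangle.$$
   Context: For a set $C$ and $z\in C$: $T_C(z)=\{u\mid\exists t_k\downarrow0,u_k\to u: z+t_ku_k\in C\}$; for $u\in T_C(z)$, $T_C^2(z;u)=\{w\mid\exists t_k\downarrow0,w_k\to w: z+t_ku+\frac12t_k^2w_k\in C\}$; $\widehat N_C$ and $N_C$ are the regular (Fréchet) and limiting (Mordukhovich) normal cones (empty outside $C$). For a set $C$, $C^+:=\mathrm{span}(C-C)$. For $z\in\Gamma$, $L_z:=\{w\mid\nabla G(z)w\in(T_D(G(z)))^+\}$. A minimum over the empty set is $+\infty$. $\Sigma_{\bar\omega}:=\{z\mid\text{for every sequence }\omega^k\to\bar\omega\text{ with }\omega^k\in\Omega\text{ there exist }z^k\to z\text{ with }z^k\in B^{-1}(\omega^k)\cap\Gamma\}$. For $\omega\in\Omega\cap\mathcal O$ and $\eta\in T_\Omega(\omega)$,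 $\hat z'(\omega;\eta)\in T_\Gamma(\hat z(\omega))$ denotes the limit $\lim_{k\to\infty}\big(\hat z(\omega+t_k\eta_k)-\hat z(\omega)\big)/t_k$, which (in this setting) exists and is the same for all sequences $t_k\downarrow0$, $\eta_k\to\eta$ with $\omega+t_k\eta_k\in\Omega$; it is the unique $w$ with $\nabla B(\hat z(\omega))w=\eta$ and $w\in L_{\hat z(\omega)}$. Second subderivative of the indicator function $\delta_C$ at $z\in C$: $\mathrm{d}^2\delta_C(z;z^* )(u)=\liminf_{t\downarrow0,\,u'\to u,\,z+tu'\in C}\frac{-2\langle z^*,u'\rangle}{t}$. Support function: $\sigma_C(\lambda)=\sup_{u\in C}\langle\lambda,u\rangle$ ($=-\infty$ for $C=\emptyset$). Lower generalized support function: for $C\ne\emptyset$ closed, $\hat\sigma_C(\lambda)=\liminf_{\tilde\lambda\to\lambda}\inf_u\{\langle\tilde\lambda,u\rangle\mid\tilde\lambda\in N_C(u)\}=\liminf_{\tilde\lambda\to\lambda}\inf_u\{\langle\tilde\lambda,u\rangle\mid\tilde\lambda\in\widehat N_C(u)\}$ (with $\inf\emptyset=+\infty$, and $\tilde\lambda=\lambda$ allowed in the liminf); $\hat\sigma_\emptyset\equiv-\infty$. $\nabla^2B(z)(w,w)$ is the vector with components $w^T\nabla^2B_i(z)w$. *)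

(* Defs.v *)
(* Vectors of R^n are rows 'rV[R]_n over R : realType. *)
From HB Require Import structures.
From mathcomp Require Import all_boot all_order all_algebra.
From mathcomp Require Import all_classical all_reals all_analysis.
Import Order.TTheory GRing.Theory Num.Theory.
Import numFieldNormedType.Exports.

Set Implicit Arguments.
Unset Strict Implicit.
Unset Printing Implicit Defensive.

Local Open Scope classical_set_scope.
Local Open Scope ring_scope.

Section Euclidean.
Context {R : realType} {n : nat}.
Implicit Types x y : 'rV[R]_n.

Definition dot x y : R := \sum_i x 0 i * y 0 i.

(* The library norm `|x| on 'rV[R]_n is the max norm; it induces the same
   topology, but the constants below refer to the Euclidean norm. *)
Definition enorm x : R := Num.sqrt (dot x x).

End Euclidean.

Section TangentSets.
Context {R : realType} {n : nat}.
Implicit Types (C : set 'rV[R]_n) (z u v w : 'rV[R]_n) (t : R^nat).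

Definition tends_down0 t : Prop := (forall k, 0 < t k) /\ t @ \oo --> 0.

Definition tangent C z : set 'rV[R]_n :=
  [set u | exists t (u_ : nat -> 'rV[R]_n),
    [/\ tends_down0 t, u_ @ \oo --> u & forall k, C (z + t k *: u_ k)]].

Definition tangent2 C z u : set 'rV[R]_n :=
  [set w | exists t (w_ : nat -> 'rV[R]_n),
    [/\ tends_down0 t, w_ @ \oo --> w &
        forall k, C (z + t k *: u + (2^-1 * t k ^+ 2) *: w_ k)]].

(* v is a regular normal iff limsup <v, z' - z> / ||z' - z|| <= 0
   as z' tends to z within C. *)
Definition regular_normal C z : set 'rV[R]_n :=
  [set v | C z /\ forall e : R, 0 < e ->
    \forall z' \near z, C z' -> dot v (z' - z) <= e * enorm (z' - z)].

Definition limiting_normal C z : set 'rV[R]_n :=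
  [set v | C z /\ exists z_ v_ : nat -> 'rV[R]_n,
    [/\ z_ @ \oo --> z, v_ @ \oo --> v &
        forall k, regular_normal C (z_ k) (v_ k)]].

Definition linear_span C : set 'rV[R]_n :=
  [set v | exists2 s : seq 'rV[R]_n,
    (forall x, x \in s -> C x) & v \in span s].

Definition span_diff C : set 'rV[R]_n :=
  linear_span [set v | exists x y, [/\ C x, C y & v = x - y]].

Definition convex_polyhedral C : Prop :=
  exists s : seq ('rV[R]_n * R),
    C = [set x | forall h, h \in s -> dot h.1 x <= h.2].

Definition polyhedral C : Prop :=
  exists (k : nat) (P : 'I_k -> set 'rV[R]_n),
    (forall i, convex_polyhedral (P i)) /\ C = \bigcup_i P i.

End TangentSets.

Section SecondOrder.
Context {R : realType} {n : nat}.
Implicit Types (C : set 'rV[R]_n) (z u l : 'rV[R]_n).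

(* The filter is that of t > 0, u' with t -> 0, u' -> u and z + t u' in C; if
   it is improper (no such pairs nearby), the lower limit is +oo. *)
Definition subderiv2 C z (zs u : 'rV[R]_n) : \bar R :=
  limf_einf (fun p : R * 'rV[R]_n => (- 2 * dot zs p.2 / p.1)%:E)
    (within [set p : R * 'rV[R]_n | C (z + p.1 *: p.2)]
       (filter_prod (0 : R)^'+ (nbhs u))).

Definition support_fun C l : \bar R := ereal_sup [set (dot l u)%:E | u in C].

Definition lower_support_fun C l : \bar R :=
  if C == set0 then -oo%E else
  limf_einf (fun l' : 'rV[R]_n =>
      ereal_inf [set (dot l' u)%:E | u in [set u | limiting_normal C u l']])
    (nbhs l).

End SecondOrder.

Section Smooth.
Context {R : realType} {n : nat}.

(* In finite dimension, continuity of the derivative in the operator norm is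
   pointwise continuity. *)
Definition C1 {W : normedModType R} (f : 'rV[R]_n -> W) : Prop :=
  (forall x, differentiable f x) /\
  (forall v, continuous (fun x => 'd f x v)).

Definition C2 {m} (f : 'rV[R]_n -> 'rV[R]_m) : Prop :=
  C1 f /\ C1 (fun x => 'J f x).

Definition hessian (f : 'rV[R]_n -> R) (z : 'rV[R]_n) : 'M[R]_n :=
  \matrix_(i, j) 'D_(delta_mx 0 i) (fun y => 'D_(delta_mx 0 j) f y) z.

Definition quad2 {m} (f : 'rV[R]_n -> 'rV[R]_m) (z w : 'rV[R]_n) : 'rV[R]_m :=
  \row_i (w *m hessian (fun y => f y 0 i) z *m w^T) 0 0.

(* 'J f z is the n x m matrix of the differential acting on rows from the
   right, i.e. the transpose of the usual Jacobian. *)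
Definition jac_app {m} (f : 'rV[R]_n -> 'rV[R]_m) (z w : 'rV[R]_n) : 'rV[R]_m :=
  w *m 'J f z.

Definition jacT_app {m} (f : 'rV[R]_n -> 'rV[R]_m) (z : 'rV[R]_n)
    (y : 'rV[R]_m) : 'rV[R]_n :=
  y *m ('J f z)^T.

End Smooth.

Section Setting.
Context {R : realType} {n m l : nat}.
Implicit Types (B : 'rV[R]_n -> 'rV[R]_m) (G : 'rV[R]_n -> 'rV[R]_l)
  (D : set 'rV[R]_l).

Definition L_space G D (z : 'rV[R]_n) : set 'rV[R]_n :=
  [set w | span_diff (tangent D (G z)) (jac_app G z w)].

Definition Sigma B (Gamma : set 'rV[R]_n) (Omega : set 'rV[R]_m)
    (om : 'rV[R]_m) : set 'rV[R]_n :=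
  [set z | forall om_ : nat -> 'rV[R]_m,
    om_ @ \oo --> om -> (forall k, Omega (om_ k)) ->
    exists2 z_ : nat -> 'rV[R]_n, z_ @ \oo --> z &
      forall k, (B @^-1` [set om_ k] `&` Gamma) (z_ k)].

(* The common limit of the difference quotients along all admissible sequences
   (`get` returns a default value if there is none).  zhat is total, but only
   its values on Omega near om matter. *)
Definition dir_deriv (Omega : set 'rV[R]_m) (zhat : 'rV[R]_m -> 'rV[R]_n)
    (om eta : 'rV[R]_m) : 'rV[R]_n :=
  get [set w | forall (t : R^nat) (eta_ : nat -> 'rV[R]_m),
    tends_down0 t -> eta_ @ \oo --> eta ->
    (forall k, Omega (om + t k *: eta_ k)) ->
    (fun k => (t k)^-1 *: (zhat (om + t k *: eta_ k) - zhat om)) @ \oo --> w].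

End Setting.

(* Main.v *)
Require Import Defs.
From HB Require Import structures.
From mathcomp Require Import all_boot all_order all_algebra.
From mathcomp Require Import all_classical all_reals all_analysis.
From mathcomp Require Import ring.
Import Order.TTheory GRing.Theory Num.Theory.
Import numFieldNormedType.Exports.

Local Open Scope classical_set_scope.
Local Open Scope ring_scope.

(* The derivatives of B and G at z, the latter taken modulo the span L of the
   tangent cone of D, have no common kernel vector: this is the lower bound on
   L_z. So there are matrices with A E + H F = 1, where A is the derivative
   of B and H that of G followed by a matrix N with kernel L. Because D is
   polyhedral, G(y) - G(z) lies in L for every y in Gamma near z. Hence, for a
   curve in Gamma, expanding G gives the limit of the H-part of its first and
   second order difference quotients, expanding B gives that of the A-part from
   the image curve in Omega, and the identity above recombines them. This
   yields w = eta E, the description of the second order tangent set of Omega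
   as the affine image A T + q of that of Gamma, with A injective on T - T,
   and, by a change of variables in the lower limit, the formula for the second
   subderivative. *)

(** * Lower limits along filters: composition, perturbation, change of variables *)

Section LowerLimits.
Context {R : realType}.

(** Each set of [G] pulls back along [phi] to a set of [F], over which [f \o phi] only takes values
    that [f] already takes on the original set. *)
Lemma le_limf_einf_comp (T U : topologicalType) (F : set_system T)
    (G : set_system U) (phi : T -> U) (f : U -> \bar R) :
  phi @ F --> G -> (limf_einf f G <= limf_einf (f \o phi) F)%E.
Proof.
move=> phiFG; rewrite !limf_einfE; apply: ge_ereal_sup => _ [V GV <-].
apply: le_ereal_sup_tmp; exists (ereal_inf ((f \o phi) @` (phi @^-1` V))).
  by exists (phi @^-1` V) => //; exact: phiFG.
by apply: ereal_inf_le_tmp => _ [x Vx <-]; exists (phi x).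
Qed.

Lemma limf_einfD_ge {T : topologicalType} (F : set_system T) {FF : Filter F}
    (f g : T -> \bar R) (r : T -> R) (c : R) :
  r @ F --> c -> (\forall x \near F, g x = (f x + (r x)%:E)%E) ->
  (limf_einf f F + c%:E <= limf_einf g F)%E.
Proof.
move=> rc gE; rewrite -leeBrDr//; rewrite !limf_einfE.
apply: ge_ereal_sup => _ [V FV <-]; rewrite leeBrDr//.
apply/lee_subgt0Pr => e e0; apply: le_ereal_sup_tmp.
pose V' := V `&` [set x | `|c - r x| < e] `&`
  [set x | g x = (f x + (r x)%:E)%E].
exists (ereal_inf (g @` V')).
  exists V' => //; apply: filterI => //; apply: filterI => //.
  exact: (cvgr_dist_lt _ _ rc).
apply: le_ereal_inf_tmp => _ [x [[Vx /= xe] xE] <-]; rewrite xE -addeA -EFinB.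
apply: leeD; first by apply: ereal_inf_lbound; exists x.
by rewrite lee_fin lerBlDr -lerBlDl (le_trans (ler_norm _))// ltW.
Qed.

Lemma limf_einfD_cvg {T : topologicalType} (F : set_system T) {FF : Filter F}
    (f g : T -> \bar R) (r : T -> R) (c : R) :
  r @ F --> c -> (\forall x \near F, g x = (f x + (r x)%:E)%E) ->
  limf_einf g F = (limf_einf f F + c%:E)%E.
Proof.
move=> rc gE; apply/eqP; rewrite eq_le; apply/andP; split; last first.
  exact: limf_einfD_ge rc gE.
(* The reverse inequality is the first one with [f] and [g] exchanged and [r] negated. *)
rewrite -leeBlDr//; apply: (@limf_einfD_ge _ _ _ _ _ (fun x => - r x)).
  exact: cvgN.
by apply: filterS gE => x ->; rewrite -addeA -EFinB subrr adde0.
Qed.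

(** A one-sided inverse is enough: composing with [phi] and then with [psi] can only raise the lower
    limit, and it ends at that of [f] again, so both inequalities are equalities. *)
Lemma limf_einf_change_var (T U : topologicalType) (F : set_system T)
    {FF : Filter F} (G : set_system U) {FG : Filter G}
    (phi : T -> U) (psi : U -> T) (f : U -> \bar R) (g : T -> \bar R)
    (r : T -> R) (c : R) :
  phi @ F --> G -> psi @ G --> F -> (\forall y \near G, phi (psi y) = y) ->
  r @ F --> c -> (\forall x \near F, f (phi x) = (g x + (r x)%:E)%E) ->
  limf_einf f G = (limf_einf g F + c%:E)%E.
Proof.
move=> phiFG psiGF phiK rc fE; rewrite -(limf_einfD_cvg F g (f \o phi) r c) //.
apply/eqP; rewrite eq_le le_limf_einf_comp //=.
rewrite (le_trans (le_limf_einf_comp _ _ _ _ _ _ psiGF)) //.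
rewrite (limf_einfD_cvg G f (f \o phi \o psi) (cst 0) 0) ?adde0 //.
  exact: cvg_cst.
by apply: filterS phiK => y /= ->; rewrite adde0.
Qed.

Lemma ereal_supD_EFin (T : Type) (C : set T) (f : T -> \bar R) (c : R) :
  ereal_sup [set (f x + c%:E)%E | x in C] = (ereal_sup (f @` C) + c%:E)%E.
Proof.
apply/eqP; rewrite eq_le; apply/andP; split.
  apply: ge_ereal_sup => _ [x Cx <-]; apply: leeD => //.
  by apply: ereal_sup_ubound; exists x.
rewrite -leeBrDr//; apply: ge_ereal_sup => _ [x Cx <-]; rewrite leeBrDr//.
by apply: ereal_sup_ubound; exists x.
Qed.

Lemma ereal_infD_EFin (T : Type) (C : set T) (f : T -> \bar R) (c : R) :
  ereal_inf [set (f x + c%:E)%E | x in C] = (ereal_inf (f @` C) + c%:E)%E.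
Proof.
apply/eqP; rewrite eq_le; apply/andP; split; last first.
  apply: le_ereal_inf_tmp => _ [x Cx <-]; apply: leeD => //.
  by apply: ereal_inf_lbound; exists x.
rewrite -leeBlDr//; apply: le_ereal_inf_tmp => _ [x Cx <-]; rewrite leeBlDr//.
by apply: ereal_inf_lbound; exists x.
Qed.

End LowerLimits.

(** * Inner product, Euclidean and max norm, and coordinatewise limits of row vectors *)

Section RowVectors.
Context {R : realType}.

Lemma dotE n (x y : 'rV[R]_n) : dot x y = (x *m y^T) 0 0.
Proof. by rewrite /dot mxE; apply: eq_bigr => i _; rewrite mxE. Qed.

Lemma dotDl n (x y v : 'rV[R]_n) : dot (x + y) v = dot x v + dot y v.
Proof. by rewrite !dotE mulmxDl mxE. Qed.

Lemma dotDr n (v x y : 'rV[R]_n) : dot v (x + y) = dot v x + dot v y.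
Proof. by rewrite !dotE linearD /= mulmxDr mxE. Qed.

Lemma dotNl n (x v : 'rV[R]_n) : dot (- x) v = - dot x v.
Proof. by rewrite !dotE mulNmx mxE. Qed.

Lemma dotBl n (x y v : 'rV[R]_n) : dot (x - y) v = dot x v - dot y v.
Proof. by rewrite !dotE mulmxBl !mxE. Qed.

Lemma dotBr n (v x y : 'rV[R]_n) : dot v (x - y) = dot v x - dot v y.
Proof. by rewrite !dotE linearB /= mulmxBr !mxE. Qed.

Lemma dotZr n a (v x : 'rV[R]_n) : dot v (a *: x) = a * dot v x.
Proof. by rewrite !dotE linearZ /= -scalemxAr !mxE. Qed.

Lemma dot_mulmx n m (A : 'M[R]_(n, m)) (y : 'rV_m) (x : 'rV_n) :
  dot (y *m A^T) x = dot y (x *m A).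
Proof. by rewrite !dotE trmx_mul mulmxA. Qed.

Lemma enorm_ge0 n (x : 'rV[R]_n) : 0 <= enorm x.
Proof. exact: sqrtr_ge0. Qed.

Lemma enorm0 n : enorm (0 : 'rV[R]_n) = 0.
Proof. by rewrite /enorm dotE mul0mx mxE sqrtr0. Qed.

Lemma le_coord_enorm n (x : 'rV[R]_n) j : `|x 0 j| <= enorm x.
Proof.
rewrite -sqrtr_sqr ler_wsqrtr // expr2 /dot (bigD1 j) //= lerDl.
by apply: sumr_ge0 => i _; rewrite -expr2 sqr_ge0.
Qed.

Lemma le_enorm_sum n (x : 'rV[R]_n) : enorm x <= \sum_j `|x 0 j|.
Proof.
have s0 : 0 <= \sum_j `|x 0 j| by apply: sumr_ge0.
rewrite -(ger0_norm s0) -sqrtr_sqr ler_wsqrtr // expr2 mulr_suml.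
apply: ler_sum => i _; rewrite (le_trans (ler_norm _)) // normrM ler_wpM2l //.
by rewrite (bigD1 i) //= lerDl sumr_ge0.
Qed.

Lemma enorm_eq0 n (x : 'rV[R]_n) : enorm x <= 0 -> x = 0.
Proof.
move=> x0; apply/rowP => j; rewrite mxE; apply/eqP; rewrite -normr_le0.
exact: le_trans (le_coord_enorm _ _ _) x0.
Qed.

Lemma mx_norm_leP m n (x : 'M[R]_(m, n)) (c : R) : 0 <= c ->
  reflect (forall i j, `|x i j| <= c) (`|x| <= c).
Proof.
move=> c0; rewrite [`|x|]/Num.norm /= mx_normrE.
apply: (iffP idP) => [/bigmax_leP[_ h] i j|h].
  exact: (h (i, j)).
by apply/bigmax_leP; split => // -[i j] _ /=.
Qed.

Lemma le_coord_mx_norm m n (x : 'M[R]_(m, n)) i j : `|x i j| <= `|x|.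
Proof. exact/mx_norm_leP. Qed.

Lemma mx_norm_le_enorm n (x : 'rV[R]_n) : `|x| <= enorm x.
Proof.
apply/mx_norm_leP => [|i j]; first exact: enorm_ge0.
by rewrite ord1 le_coord_enorm.
Qed.

Lemma enorm_le_mx_norm n (x : 'rV[R]_n) : enorm x <= n%:R * `|x|.
Proof.
rewrite (le_trans (le_enorm_sum _ _)) // -[n in n%:R]card_ord -sum1_card.
rewrite natr_sum mulr_suml ler_sum // => j _; rewrite mul1r.
exact: le_coord_mx_norm.
Qed.

Lemma enorm_mulmx n m (A : 'M[R]_(n, m)) :
  exists2 c, 0 < c & forall x, enorm (x *m A) <= c * enorm x.
Proof.
pose c := \sum_j \sum_i `|A i j|.
have c0 : 0 <= c by apply: sumr_ge0 => j _; apply: sumr_ge0.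
(* The summand 1 keeps the constant positive even for [A = 0], so that it can be divided by. *)
exists (1 + c) => [|x]; first by rewrite ltr_pwDl.
rewrite (le_trans (le_enorm_sum _ _)) // mulrDl mul1r.
rewrite -[leLHS]add0r lerD ?enorm_ge0 // mulr_suml ler_sum // => j _.
rewrite mxE mulr_suml (le_trans (ler_norm_sum _ _ _)) // ler_sum // => i _.
by rewrite normrM mulrC ler_wpM2l // le_coord_enorm.
Qed.

Lemma cvg_rVP {T : Type} {F : set_system T} {FF : Filter F} n
    (f : T -> 'rV[R]_n) (y : 'rV[R]_n) :
  (forall j, (fun x => f x 0 j) @ F --> y 0 j) -> f @ F --> y.
Proof.
move=> fy; apply/cvgrPdist_le => e e0; have := ltW e0 => {}le0.
have : \forall x \near F, forall j, `|y 0 j - f x 0 j| <= e.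
  by apply: filter_forall => j; have /cvgrPdist_le := fy j; apply.
apply: filterS => x xe; apply/mx_norm_leP => // i j.
by rewrite ord1 !mxE.
Qed.

Lemma cvg_coord {T : Type} {F : set_system T} {FF : Filter F} m n
    (f : T -> 'M[R]_(m, n)) (y : 'M[R]_(m, n)) i j : 
  f @ F --> y -> (fun x => f x i j) @ F --> y i j.
Proof.
move=> fy; have := @coord_continuous R m n i j y; exact: cvg_comp fy.
Qed.

Lemma cvg_mulmx {T : Type} {F : set_system T} {FF : Filter F} n m
    (A : 'M[R]_(n, m)) (f : T -> 'rV[R]_n) (y : 'rV[R]_n) :
  f @ F --> y -> (fun x => f x *m A) @ F --> y *m A.
Proof.
move=> fy; apply: cvg_rVP => j; rewrite mxE; under eq_fun do rewrite mxE.
apply: cvg_big => [|i _]; first exact: add_continuous.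
apply: cvgMr_tmp; exact: cvg_coord.
Qed.

(** With a left inverse in place of [A], the map [v + (x - u) *m A] leads from an affine image back
    to its source; with transposes it lifts dual vectors. *)
Lemma cvg_add_mulmxB {T : Type} {F : set_system T} {FF : Filter F} n m
    (A : 'M[R]_(n, m)) (f : T -> 'rV[R]_n) (u : 'rV[R]_n) (v : 'rV[R]_m) :
  f @ F --> u -> (fun i => v + (f i - u) *m A) @ F --> v.
Proof.
move=> fu; rewrite -[X in _ --> X]addr0; apply: cvgD; first exact: cvg_cst.
rewrite -(mul0mx _ A) -(subrr u).
by apply: cvg_mulmx; apply: cvgB => //; exact: cvg_cst.
Qed.

Lemma cvg_dot {T : Type} {F : set_system T} {FF : Filter F} n
    (f g : T -> 'rV[R]_n) (x y : 'rV[R]_n) :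
  f @ F --> x -> g @ F --> y -> (fun t => dot (f t) (g t)) @ F --> dot x y.
Proof.
move=> fx gy; apply: cvg_big => [|i _]; first exact: add_continuous.
by apply: cvgM; exact: cvg_coord.
Qed.

End RowVectors.

(** * Normals and support functions of an affine image *)

Section AffineImage.
Context {R : realType} {n m : nat}.
Variables (A : 'M[R]_(n, m)) (q : 'rV[R]_m).
Variables (T : set 'rV[R]_n) (E : 'M[R]_(m, n)).
(** [A] need not be injective on the whole space. In the application [T] is a second order tangent
    set, which lies in a translate of the kernel of [H], and there A E + H F = 1 reduces to this
    identity. *)
Hypothesis TAE : forall u v, T u -> T v -> (u - v) *m A *m E = u - v.

Let TA := [set v *m A + q | v in T].

Lemma support_fun_affine_image y :
  support_fun TA y = (support_fun T (y *m A^T) + (dot y q)%:E)%E.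
Proof.
rewrite /support_fun -ereal_supD_EFin; congr ereal_sup.
rewrite image_comp; apply: eq_imagel => v _ /=.
by rewrite dotDr dot_mulmx EFinD.
Qed.

Lemma affine_subK u v : u *m A + q - (v *m A + q) = (u - v) *m A.
Proof. by rewrite mulmxBl opprD addrACA subrr addr0. Qed.

Lemma cvg_affine {I : Type} {F : set_system I} {FF : Filter F}
    (f : I -> 'rV[R]_n) (v : 'rV[R]_n) :
  f @ F --> v -> (fun i => f i *m A + q) @ F --> v *m A + q.
Proof. by move=> fv; apply: cvgD; [exact: cvg_mulmx | exact: cvg_cst]. Qed.

(** Points of [T] near [v] and points of the image correspond through the affine map and its inverse
    built from [E], both continuous. Inner products agree by adjunction, and distances change at
    most by a factor [c], which is absorbed by using [e / c]. *)
Lemma regular_normal_affine_image v y : T v ->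
  regular_normal TA (v *m A + q) y <-> regular_normal T v (y *m A^T).
Proof.
move=> Tv; split=> -[_ yN]; split=> //; [|by exists v|].
- move=> e e0; have [c c0 cA] := enorm_mulmx _ _ A.
  have {}yN : \forall u \near v, TA (u *m A + q) ->
      dot y (u *m A + q - (v *m A + q)) <=
      e / c * enorm (u *m A + q - (v *m A + q)).
    exact: (@cvg_affine _ (nbhs v) _ id v cvg_id _ (yN _ (divr_gt0 e0 c0))).
  apply: filterS yN => u uN Tu; have {uN} := uN (imageP _ Tu).
  rewrite affine_subK dot_mulmx => /le_trans; apply.
  by rewrite mulrAC ler_pdivrMr // -mulrA ler_pM2l // mulrC.
- move=> e e0; have [c c0 cE] := enorm_mulmx _ _ E.
  have {}yN : \forall u \near v *m A + q, T (v + (u - (v *m A + q)) *m E) ->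
      dot (y *m A^T) (v + (u - (v *m A + q)) *m E - v) <=
      e / c * enorm (v + (u - (v *m A + q)) *m E - v).
    exact: (@cvg_add_mulmxB _ _ (nbhs (v *m A + q)) _ _ _ E id _ v cvg_id _
      (yN _ (divr_gt0 e0 c0))).
  apply: filterS yN => _ /[swap] -[u Tu <-].
  rewrite affine_subK TAE // subrKC => /(_ Tu).
  rewrite dot_mulmx => /le_trans; apply.
  rewrite mulrAC ler_pdivrMr // -mulrA ler_pM2l //.
  by rewrite -[in leLHS](TAE _ _ Tu Tv) mulrC cE.
Qed.

(** The inequality defining a regular normal tests only differences of points of [T], to which [r]
    is orthogonal. *)
Lemma limiting_normal_perp v y r :
  (forall u u', T u -> T u' -> dot r (u - u') = 0) ->
  limiting_normal T v y -> limiting_normal T v (y + r).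
Proof.
move=> r0 [Tv [v_ [y_ [v_v y_y yN]]]]; split=> //.
exists v_, (fun k => y_ k + r); split=> // [|k].
  by apply: cvgD => //; exact: cvg_cst.
have [Tvk ykN] := yN k; split=> // e /ykN; apply: filterS => u uN Tu.
by rewrite dotDl r0 // addr0 uN.
Qed.

Lemma limiting_normal_affine_image v y : T v ->
  limiting_normal TA (v *m A + q) y <-> limiting_normal T v (y *m A^T).
Proof.
move=> Tv; split=> -[_].
- move=> [u_ [y_ [u_u y_y yN]]]; split=> //.
  exists (fun k => v + (u_ k - (v *m A + q)) *m E), (fun k => y_ k *m A^T).
  split=> [||k]; [exact: cvg_add_mulmxB|exact: cvg_mulmx|].
  have [[w Tw wu] _] := yN k.
  by rewrite -wu affine_subK TAE // subrKC -regular_normal_affine_image // wu.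
- move=> [v_ [y_ [v_v y_y yN]]]; split; first by exists v.
  (* The [y_ k] need not lie in the range of [A^T]. The vectors chosen here tend to [y], and their
     images under [A^T] have the same inner products as [y_ k] with all differences of points of
     [T]. *)
  exists (fun k => v_ k *m A + q), (fun k => y + (y_ k - y *m A^T) *m E^T).
  split=> [||k]; [exact: cvg_affine| |].
    exact: cvg_add_mulmxB.
  have [Tvk ykN] := yN k; rewrite regular_normal_affine_image //; split=> //.
  move=> e /ykN; apply: filterS => u uN Tu; rewrite dot_mulmx dotDl.
  by rewrite dot_mulmx TAE // dotBl dot_mulmx subrKC uN.
Qed.

(** On the image side the lower limit runs only over vectors [z *m A^T], on the side of [T] over all
    vectors near [y *m A^T]. An arbitrary vector is replaced by one in the range of [A^T] that
    differs from it by a vector orthogonal to T - T; this changes [h] by a term tending to 0. *)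
Lemma lower_support_fun_affine_image y :
  lower_support_fun TA y = (lower_support_fun T (y *m A^T) + (dot y q)%:E)%E.
Proof.
(* For empty [T] both sides are -oo by convention. *)
rewrite /lower_support_fun; have [T0|T0] := eqVneq T set0.
  by rewrite /TA T0 image_set0 eqxx.
have [v0 Tv0] : T !=set0 by apply/set0P.
have /negPf -> : TA != set0 by apply/set0P; exists (v0 *m A + q), v0.
pose h (z : 'rV[R]_n) :=
  ereal_inf [set (dot z v)%:E | v in [set v | limiting_normal T v z]].
have hTA (z : 'rV[R]_m) : ereal_inf
    [set (dot z u)%:E | u in [set u | limiting_normal TA u z]] =
    (h (z *m A^T) + (dot z q)%:E)%E.
  rewrite /h -ereal_infD_EFin; congr ereal_inf; apply/seteqP; split=> x.
    move=> [u uN <-]; have [[v Tv vu] _] := uN; exists v.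
      by rewrite /= -limiting_normal_affine_image // vu.
    by rewrite -vu dotDr dot_mulmx EFinD.
  move=> [v vN <-]; have [Tv _] := vN; exists (v *m A + q).
    by rewrite /= limiting_normal_affine_image.
  by rewrite dotDr dot_mulmx EFinD.
under eq_fun do rewrite hTA.
pose phi (z : 'rV[R]_n) := y + (z - y *m A^T) *m E^T.
have perp (z u u' : 'rV[R]_n) :
    T u -> T u' -> dot (phi z *m A^T - z) (u - u') = 0.
  move=> Tu Tu'; rewrite dotBl dot_mulmx dotDl dot_mulmx TAE // dotBl.
  by rewrite dot_mulmx subrKC subrr.
(* The two vectors have the same limiting normal points, and the inner product with their difference
   is constant on [T], hence equal to its value at [v0]. *)
have hphi z : h (phi z *m A^T) = (h z + (dot (phi z *m A^T - z) v0)%:E)%E.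
  rewrite /h -ereal_infD_EFin; set z' := phi z *m A^T.
  have zN : limiting_normal T ^~ z' = limiting_normal T ^~ z.
    apply/funext => v; apply/propext; split=> vN.
      rewrite -(subrKC z' z); apply: limiting_normal_perp vN.
      by move=> u u' Tu Tu'; rewrite -opprB dotNl perp ?oppr0.
    rewrite -(subrKC z z'); apply: limiting_normal_perp vN.
    by move=> u u' Tu Tu'; rewrite perp.
  congr ereal_inf; rewrite zN; apply: eq_imagel => v [Tv _].
  have /eqP := perp z v v0 Tv Tv0; rewrite dotBr subr_eq0 => /eqP <-.
  by rewrite -EFinD dotBl subrKC.
have cA : z *m A^T @[z --> y] --> y *m A^T.
  exact: (@cvg_mulmx _ _ (nbhs y) _ _ _ A^T id y cvg_id).
have cphi : phi z @[z --> y *m A^T] --> y.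
  exact: (@cvg_add_mulmxB _ _ (nbhs (y *m A^T)) _ _ _ E^T id _ y cvg_id).
have h_lim : limf_einf (fun z : 'rV[R]_m => h (z *m A^T)) (nbhs y) =
    limf_einf h (nbhs (y *m A^T)).
  apply/eqP; rewrite eq_le (le_limf_einf_comp _ _ _ _ _ _ cA) andbT.
  rewrite (le_trans (le_limf_einf_comp _ _ _ _ _ _ cphi)) //.
  rewrite (limf_einfD_cvg _ h _
    (fun z : 'rV[R]_n => dot (phi z *m A^T - z) v0) 0).
  - by rewrite adde0.
  - rewrite -[X in _ --> X](_ : dot (y *m A^T - y *m A^T) v0 = _).
      apply: cvg_dot; last exact: cvg_cst.
      by apply: cvgB => //; exact: cvg_mulmx.
    by rewrite subrr dotE mul0mx mxE.
  - exact: nearW.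
rewrite -h_lim; apply: (limf_einfD_cvg _ _ _ (fun z : 'rV[R]_m => dot z q)).
  by apply: cvg_dot => //; exact: cvg_cst.
exact: nearW.
Qed.

End AffineImage.

(** * First and second order Taylor expansions along a filter *)

Section Taylor.
Context {R : realType}.

Lemma diff_remainder (V W : normedModType R) (f : V -> W) (z : V) :
  differentiable f z -> forall e, 0 < e ->
  \forall h \near 0, `|f (z + h) - f z - 'd f z h| <= e * `|h|.
Proof.
move=> /diff_locallyP[_ /eqaddoP fz] e e0; apply: filterS (fz _ e0) => h.
by rewrite !fctE /= opprD addrA [h + z]addrC.
Qed.

Lemma jac_appE n m (f : 'rV[R]_n -> 'rV[R]_m) z w : w *m 'J f z = 'd f z w.
Proof. exact: mul_rV_lin1. Qed.

Lemma is_derive_coord (V : normedModType R) p q (f : V -> 'M[R]_(p, q))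
    (a v : V) i j :
  differentiable f a -> is_derive a v (fun y => f y i j) ('d f a v i j).
Proof.
move=> fa; have fv : derivable f a v by exact: diff_derivable.
have c : h^-1 *: (f (h *: v + a) i j - f a i j) @[h --> 0^'] --> 'd f a v i j.
  rewrite -deriveE //; have := @cvg_coord _ _ _ (dnbhs_filter _) _ _ _ _ i j fv.
  by under eq_fun do rewrite !mxE.
by split; [apply/cvg_ex; exists ('d f a v i j) | exact: cvg_lim].
Qed.

Lemma is_derive_coord_line n p q (f : 'rV[R]_n -> 'M[R]_(p, q)) z h s i j :
  differentiable f (z + s *: h) ->
  is_derive s 1 (fun s : R => f (z + s *: h) i j) ('d f (z + s *: h) h i j).
Proof.
move=> fs; have [dh <-] := is_derive_coord _ _ _ _ _ h i j fs.
have quotE : (fun e : R =>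
    e^-1 *: (((fun s : R => f (z + s *: h) i j) \o shift s) (e *: 1)
    - f (z + s *: h) i j)) =
  (fun e : R => e^-1 *: (((fun y => f y i j) \o shift (z + s *: h)) (e *: h)
    - f (z + s *: h) i j)).
  apply/funext => e /=; congr (_ *: (f _ _ _ - _)).
  by rewrite [e%:A]mulr1 scalerDl addrCA.
by split; rewrite /derivable /derive quotE.
Qed.

(** The entry (j, k) of ['J f y] is the j-th partial derivative of the k-th component, so Hessian
    entries are entries of the differential of the Jacobian, the form in which [C2] supplies
    estimates. *)
Lemma quad2E n m (f : 'rV[R]_n -> 'rV[R]_m) z w k : C2 f ->
  quad2 f z w 0 k = (w *m 'd (fun y => 'J f y) z w) 0 k.
Proof.
move=> [[df _] [dJ _]].
have hE : hessian (fun y => f y 0 k) z =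
    \matrix_(i, j) 'd (fun y => 'J f y) z (delta_mx 0 i) j k.
  apply/matrixP => i j; rewrite !mxE (_ : (fun y => _) = (fun y => 'J f y j k)).
    by have [] := is_derive_coord _ _ _ _ _ (delta_mx 0 i) j k (dJ z).
  apply/funext => y.
  have [_ ->] := is_derive_coord _ _ _ _ _ (delta_mx 0 j) 0 k (df y).
  by rewrite -jac_appE -rowE mxE.
rewrite mxE hE !mxE; apply: eq_bigr => j _.
rewrite !mxE mulrC; congr (_ * _).
rewrite [w in 'd _ _ w]row_sum_delta linear_sum summxE.
by apply: eq_bigr => i _; rewrite linearZ !mxE.
Qed.

Lemma is_derive_subquadratic (u : R -> R) (du s a b : R) :
  is_derive s 1 u du ->
  is_derive s 1 (fun s => u s - s * a - s ^+ 2 * (2^-1 * b)) (du - a - s * b).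
Proof.
move=> du1; have id1 := is_derive_id s (1 : R).
have cst1 (c : R) := is_derive_cst c s (1 : R).
have [d1 d2] := is_deriveB (is_deriveB du1 (is_deriveM id1 (cst1 a)))
  (is_deriveM (is_deriveM id1 id1) (cst1 (2^-1 * b))).
split; first exact: d1.
apply: (etrans d2).
change (du - (s * 0 + a * 1) - (s * s * 0 + 2^-1 * b * (s * 1 + s * 1)) =
  du - a - s * b); by field.
Qed.

(** In each component the mean value theorem on [0, 1] turns the second order remainder into [h]
    times the first order remainder of the Jacobian at an intermediate [c *: h], which is small
    relative to [h]. *)
Lemma taylor2 n m (f : 'rV[R]_n -> 'rV[R]_m) (z : 'rV[R]_n) : C2 f ->
  forall e, 0 < e -> \forall h \near (0 : 'rV[R]_n),
    `|f (z + h) - f z - h *m 'J f z - 2^-1 *: quad2 f z h| <= e * `|h| ^+ 2.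
Proof.
move=> f2 e e0; have [[df _] [dJ _]] := f2.
(* Dividing [e] by n + 1 absorbs the sum over the n entries of [h] and remains possible for n =
   0. *)
have n0 : 0 < n.+1%:R :> R by rewrite ltr0n.
have := diff_remainder _ _ _ _ (dJ z) _ (divr_gt0 e0 n0).
move=> /nbhs_normP[d /= d0 Jd].
have : \forall h \near (0 : 'rV[R]_n), `|h| < d.
  exact: pseudometric_normed_Zmodule.nbhs0_lt.
apply: filterS => h hd.
apply/mx_norm_leP => [|i k]; first by rewrite mulr_ge0 ?exprn_ge0 // ltW.
rewrite ord1 {i}.
pose g (s : R) := f (z + s *: h) 0 k - s * (h *m 'J f z) 0 k
   - s ^+ 2 * (2^-1 * quad2 f z h 0 k).
pose dg (s : R) := (h *m 'J f (z + s *: h)) 0 k - (h *m 'J f z) 0 k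
   - s * quad2 f z h 0 k.
have gdg (s : R) : is_derive s 1 g (dg s).
  apply: is_derive_subquadratic; rewrite jac_appE.
  exact: is_derive_coord_line (df _).
have gc : {within `[0, 1], continuous g}.
  by apply: derivable_within_continuous => s _; have [] := gdg s.
have [c /andP[c0 c1]] := MVT ltr01 (fun s _ => gdg s) gc.
rewrite subr0 mulr1 {1 2}/g !scale1r scale0r addr0 !mul0r expr1n !mul1r.
rewrite expr0n mul0r !subr0 => gE.
have mxB (x y : 'rV[R]_m) : (x - y) 0 k = x 0 k - y 0 k by rewrite !mxE.
have mxZ a (x : 'rV[R]_m) : (a *: x) 0 k = a * x 0 k by rewrite mxE.
pose M := 'J f (z + c *: h) - 'J f z - 'd (fun y => 'J f y) z (c *: h).
have -> : (f (z + h) - f z - h *m 'J f z - 2^-1 *: quad2 f z h) 0 k =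
    (h *m M) 0 k.
  rewrite /M ['d _ _ _]linearZ !mulmxBr -scalemxAr !mxB !mxZ -quad2E //.
  by rewrite -/(dg c) -gE; ring.
have Mle : `|M| <= e / n.+1%:R * `|h|.
  have ch : `|c *: h| <= `|h|.
    by rewrite normrZ ler_piMl // ger0_norm ltW.
  have /Jd /= /le_trans : ball_ Num.norm 0 d (c *: h).
    by rewrite /ball_ /= sub0r normrN (le_lt_trans ch).
  by apply; rewrite ler_wpM2l // ltW // divr_gt0.
rewrite mxE (le_trans (ler_norm_sum _ _ _)) //.
apply: (@le_trans _ _ (\sum_(j < n) `|h| * (e / n.+1%:R * `|h|))).
  apply: ler_sum => j _; rewrite normrM ler_pM ?le_coord_mx_norm //.
  by rewrite (le_trans _ Mle) // le_coord_mx_norm.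
rewrite sumr_const card_ord -[_ *+ n]mulr_natr.
have -> : `|h| * (e / n.+1%:R * `|h|) * n%:R =
   e * `|h| ^+ 2 * (n%:R / n.+1%:R) by ring.
rewrite ler_piMr ?mulr_ge0 ?exprn_ge0 // ?(ltW e0) //.
by rewrite ler_pdivrMr // mul1r ler_nat.
Qed.

Lemma cvg_scale0_bounded {T : Type} {F : set_system T} {FF : Filter F}
    (V : normedModType R) (t : T -> R) (h : T -> V) (M : R) :
  t @ F --> 0 -> (\forall x \near F, `|h x| <= M) ->
  (fun x => t x *: h x) @ F --> 0.
Proof.
move=> t0 hM; apply/cvgr0Pnorm_le => e e0.
have M0 : 0 < `|M| + 1 by rewrite ltr_wpDl.
have te : \forall x \near F, `|t x| <= e / (`|M| + 1).
  by apply: (cvgr0_norm_le _ t0); rewrite divr_gt0.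
apply: filterS2 hM te => x hM te; rewrite normrZ -[leRHS](divfK (lt0r_neq0 M0)).
apply: ler_pM => //; apply: (le_trans hM); apply: (le_trans (ler_norm _)).
by rewrite lerDl.
Qed.

(** The directions are only assumed bounded: for the quotients of [zhat], convergence is what this
    expansion serves to prove. *)
Lemma taylor1_cvg {T : Type} {F : set_system T} {FF : Filter F} n m
    (f : 'rV[R]_n -> 'rV[R]_m) z (t : T -> R) (h : T -> 'rV[R]_n) (M : R) :
  differentiable f z -> t @ F --> 0 -> (\forall x \near F, 0 < t x) ->
  (\forall x \near F, `|h x| <= M) ->
  (fun x => (t x)^-1 *: (f (z + t x *: h x) - f z) - h x *m 'J f z) @ F -->
    (0 : 'rV[R]_m).
Proof.
move=> df t0 tgt0 hM; apply/cvgr0Pnorm_le => e e0.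
have M0 : 0 < `|M| + 1 by rewrite ltr_wpDl.
have rem : \forall x \near F, `|f (z + t x *: h x) - f z - 'd f z (t x *: h x)|
    <= e / (`|M| + 1) * `|t x *: h x|.
  have := diff_remainder _ _ _ _ df _ (divr_gt0 e0 M0).
  exact: cvg_scale0_bounded t0 hM _.
apply: filterS3 rem tgt0 hM => x rem tx hx.
have -> : (t x)^-1 *: (f (z + t x *: h x) - f z) - h x *m 'J f z =
    (t x)^-1 *: (f (z + t x *: h x) - f z - 'd f z (t x *: h x)).
  by rewrite linearZ [in RHS]scalerBr scalerA mulVf ?gt_eqF // scale1r jac_appE.
rewrite normrZ gtr0_norm ?invr_gt0 // ler_pdivrMl // (le_trans rem) //.
rewrite normrZ gtr0_norm // mulrCA ler_pM2l // mulrAC ler_pdivrMr //.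
rewrite ler_pM2l // (le_trans hx) // (le_trans (ler_norm _)) //.
by rewrite lerDl.
Qed.

Lemma quad2_dot n m (f : 'rV[R]_n -> 'rV[R]_m) z w k :
  quad2 f z w 0 k = dot (w *m hessian (fun y => f y 0 k) z) w.
Proof. by rewrite mxE dotE. Qed.

Lemma quad2Z n m (f : 'rV[R]_n -> 'rV[R]_m) z a w :
  quad2 f z (a *: w) = a ^+ 2 *: quad2 f z w.
Proof.
apply/rowP => k; rewrite [RHS]mxE !quad2_dot dotZr -scalemxAl !dotE.
by rewrite -scalemxAl mxE mulrA expr2.
Qed.

Lemma taylor2_cvg {T : Type} {F : set_system T} {FF : Filter F} n m
    (f : 'rV[R]_n -> 'rV[R]_m) z (t : T -> R) (h : T -> 'rV[R]_n)
    (w : 'rV[R]_n) :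
  C2 f -> t @ F --> 0 -> (\forall x \near F, 0 < t x) -> h @ F --> w ->
  (fun x => (2 / t x ^+ 2) *:
     (f (z + t x *: h x) - f z - (t x *: h x) *m 'J f z)) @ F --> quad2 f z w.
Proof.
move=> f2 t0 tgt0 hw.
have qw : (fun x => quad2 f z (h x)) @ F --> quad2 f z w.
  apply: cvg_rVP => k; rewrite quad2_dot; under eq_fun do rewrite quad2_dot.
  by apply: cvg_dot => //; exact: cvg_mulmx.
apply: (cvg_sub0 _ qw); apply/cvgr0Pnorm_le => e e0.
pose M := `|w| + 1; have M0 : 0 < M by rewrite ltr_wpDl.
have hM : \forall x \near F, `|h x| <= M.
  by apply: (cvgr_norm_le _ hw); rewrite ltrDl.
(* The factor 2 cancels that of [2 / t x ^+ 2], and [M] bounds [h]. *)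
have e'0 : 0 < e / (2 * M ^+ 2) by rewrite divr_gt0 // mulr_gt0 // exprn_gt0.
have rem : \forall x \near F, `|f (z + t x *: h x) - f z -
    (t x *: h x) *m 'J f z - 2^-1 *: quad2 f z (t x *: h x)| <=
    e / (2 * M ^+ 2) * `|t x *: h x| ^+ 2.
  exact: cvg_scale0_bounded t0 hM _ (taylor2 _ _ _ z f2 _ e'0).
apply: filterS3 rem tgt0 hM => x /= rem tx hx; rewrite !fctE.
move: (f (z + _) - _ - _) rem => r rem.
have t2 : 0 < t x ^+ 2 by rewrite exprn_gt0.
have -> : (2 / t x ^+ 2) *: r - quad2 f z (h x) =
    (2 / t x ^+ 2) *: (r - 2^-1 *: quad2 f z (t x *: h x)).
  rewrite quad2Z scalerBr !scalerA; congr (_ - _).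
  rewrite -[LHS]scale1r; congr (_ *: _); field.
  by rewrite gt_eqF.
rewrite normrZ gtr0_norm ?divr_gt0 // mulrAC ler_pdivrMr //.
apply: (le_trans (ler_wpM2l _ rem)) => //.
have -> : 2 * (e / (2 * M ^+ 2) * `|t x *: h x| ^+ 2) =
    e * t x ^+ 2 * (`|h x| ^+ 2 / M ^+ 2).
  by rewrite normrZ gtr0_norm //; field; rewrite gt_eqF.
apply: ler_piMr; first by rewrite ltW // mulr_gt0.
by rewrite ler_pdivrMr ?exprn_gt0 // mul1r lerXn2r ?nnegrE // ltW.
Qed.

End Taylor.

(** * Linear spans as kernels, and polyhedral sets near a point *)

Section Polyhedral.
Context {R : realType} {n : nat}.
Implicit Types (C D : set 'rV[R]_n).

(** Some finite list from [C] spans a space of maximal dimension; adding a further element of [C]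
    cannot enlarge it, so it is the whole span. [N] is the identity minus a projection onto it. *)
Lemma linear_span_kernel C :
  exists N : 'M[R]_n, forall v, linear_span C v <-> v *m N = 0.
Proof.
pose P d := `[< exists2 s : seq 'rV[R]_n,
  (forall x, x \in s -> C x) & \dim (span s) = d >].
have P0 : exists d, P d.
  by exists (\dim (span ([::] : seq 'rV[R]_n))); apply/asboolP; exists [::].
have Pn d : P d -> (d <= \dim (fullv : {vspace 'rV[R]_n}))%N.
  by move=> /asboolP[s _ <-]; rewrite dimvS // subvf.
have [d /asboolP[s sC sd] dmax] := ex_maxnP P0 Pn.
have spanE v : linear_span C v <-> v \in span s.
  split=> [[s' s'C vs']|vs]; last by exists s.
  suff /subvP : (span s' <= span s)%VS by apply.
  apply/span_subvP => x xs'.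
  have dx : (\dim (span (x :: s)) <= d)%N.
    apply: dmax; apply/asboolP; exists (x :: s) => // y.
    by rewrite inE => /predU1P[->|/sC//]; exact: s'C.
  have /dimv_leqif_sup[dle] : (span s <= span (x :: s))%VS.
    by rewrite span_cons addvSr.
  rewrite eqn_leq dle sd dx => /esym /subvP; apply.
  by rewrite memv_span // inE eqxx.
exists (lin1_mx (\1 - projv (span s))%VF) => v.
rewrite mul_rV_lin1 /= add_lfunE opp_lfunE id_lfunE.
rewrite spanE; split=> [/projv_id ->|/eqP]; first by rewrite subrr.
by rewrite subr_eq0 => /eqP ->; exact: memv_proj.
Qed.

Lemma tangent0 C (d : 'rV[R]_n) : C d -> tangent C d 0.
Proof.
move=> Cd; exists harmonic, (cst 0); split; [|exact: cvg_cst|].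
  by split; [exact: harmonic_gt0 | exact: cvg_harmonic].
by move=> k; rewrite scaler0 addr0.
Qed.

(** The segment from [d] to [y] stays in [C], so the constant direction [y - d] works with steps at
    most 1. *)
Lemma convex_polyhedral_tangent C (d y : 'rV[R]_n) :
  convex_polyhedral C -> C d -> C y -> tangent C d (y - d).
Proof.
move=> [s ->] sd sy; exists harmonic, (cst (y - d)); split.
- by split; [exact: harmonic_gt0 | exact: cvg_harmonic].
- exact: cvg_cst.
move=> k h hs /=; set t := _^-1.
have t0 : 0 <= t by rewrite invr_ge0.
have t1 : t <= 1 by rewrite invf_le1 // ler1n.
rewrite dotDr dotZr dotBr; have := sd _ hs; have := sy _ hs.
set a := dot _ y; set b := dot _ d => ay bd.
have -> : b + t * (a - b) = (1 - t) * b + t * a by ring.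
have -> : h.2 = (1 - t) * h.2 + t * h.2 by ring.
by rewrite lerD // ler_wpM2l // subr_ge0.
Qed.

(** An inequality violated at [d] is violated nearby, and there are finitely many of them. *)
Lemma convex_polyhedral_closed C (d : 'rV[R]_n) :
  convex_polyhedral C -> \forall y \near d, C y -> C d.
Proof.
move=> [s ->].
elim: s => [|h s IH]; first by apply: filterE => y _ h.
have hd : \forall y \near d, dot h.1 y <= h.2 -> dot h.1 d <= h.2.
  have [le_hd|lt_hd] := leP (dot h.1 d) h.2; first by apply: filterE => y _.
  have hcvg : dot h.1 y @[y --> d] --> dot h.1 d.
    exact: (@cvg_dot _ _ (nbhs d) _ _ (cst h.1) id _ _ (cvg_cst _) cvg_id).
  have : \forall y \near d, h.2 < dot h.1 y by exact: (cvgr_gt _ hcvg).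
  by apply: filterS => y /lt_geF ->.
apply: filterS2 hd IH => y hd IH sy g; rewrite inE => /predU1P[->|gs].
  by apply/hd/sy; rewrite inE eqxx.
by apply: IH gs => g' g's; apply: sy; rewrite inE g's orbT.
Qed.

(** Near [d] only the convex pieces containing [d] are met, and within such a piece the segment
    argument applies. This is how polyhedrality of [D] enters the proof. *)
Lemma polyhedral_tangent_near D (d : 'rV[R]_n) :
  polyhedral D -> \forall y \near d, D y -> tangent D d (y - d).
Proof.
move=> [k [P [Pconv ->]]].
have : \forall y \near d, forall i, P i y -> P i d.
  by apply: (@filter_forall _ _ _ (nbhs d)) => i;
    exact: convex_polyhedral_closed.
apply: filterS => y Py [i _ Piy].
have [t [u_ [t0 u_y Pu]]] :=
  convex_polyhedral_tangent _ _ _ (Pconv i) (Py i Piy) Piy.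
by exists t, u_; split=> // j; exists i.
Qed.

End Polyhedral.

(** * Auxiliary limits, left inverses and parabolic curves *)

Lemma cvg_near_eq {T : Type} {U : topologicalType} {F : set_system T}
    {FF : Filter F} (f g : T -> U) (y : U) :
  (\forall x \near F, f x = g x) -> f @ F --> y -> g @ F --> y.
Proof. by move=> fg; apply: cvg_trans; exact: near_eq_cvg. Qed.

Lemma cvg_seq_unique {K : numFieldType} {V : normedModType K} (f : nat -> V)
    (a b : V) :
  f @ \oo --> a -> f @ \oo --> b -> a = b.
Proof. by move=> fa fb; exact: (cvg_unique (@norm_hausdorff _ _) fa fb). Qed.

(** For matrices acting on rows, a trivial common kernel means that the block row of [A] and [H] is
    row free; the two blocks of its right inverse are [E] and [F]. *)
Lemma injective_left_inverse (K : fieldType) n m p (A : 'M[K]_(n, m))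
    (H : 'M[K]_(n, p)) :
  (forall w : 'rV_n, w *m A = 0 -> w *m H = 0 -> w = 0) ->
  exists E F, A *m E + H *m F = 1%:M.
Proof.
move=> inj; pose C := row_mx A H.
have Cfree : row_free C.
  rewrite -kermx_eq0; apply/eqP/row_matrixP => i; rewrite row0.
  have : row i (kermx C) *m C = 0 by rewrite -row_mul mulmx_ker row0.
  rewrite mul_mx_row -row_mx0 => /eq_row_mx[]; exact: inj.
exists (usubmx (pinvmx C)), (dsubmx (pinvmx C)).
by rewrite -mul_row_col vsubmxK mulmxVp.
Qed.

Lemma cvg_addZ {K : numFieldType} {V : normedModType K} {T : Type}
    {F : set_system T} {FF : Filter F} (y : V) (t : T -> K) (h : T -> V)
    (w : V) :
  t @ F --> 0 -> h @ F --> w -> (fun x => y + t x *: h x) @ F --> y.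
Proof.
move=> t0 hw; rewrite -[X in _ --> X]addr0; apply: cvgD; first exact: cvg_cst.
by rewrite -(scale0r w); exact: cvgZ.
Qed.

Lemma cvg_addZ_half {R : realType} {V : normedModType R} {T : Type}
    {F : set_system T} {FF : Filter F} (y : V) (t : T -> R) (h : T -> V)
    (w : V) :
  t @ F --> 0 -> h @ F --> w -> (fun x => y + (2^-1 * t x) *: h x) @ F --> y.
Proof.
move=> t0 hw; apply: (cvg_addZ _ _ _ w) => //.
by rewrite -(mulr0 2^-1); exact: cvgMl_tmp.
Qed.

(** A second order curve is read as a first order one with a direction tending to [w], to which the
    expansions apply. *)
Lemma parabolaE {K : numFieldType} {V : lmodType K} (y w v : V) (a : K) :
  y + a *: w + (2^-1 * a ^+ 2) *: v = y + a *: (w + (2^-1 * a) *: v).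
Proof. by rewrite scalerDr scalerA addrA; congr (_ + _ *: _); ring. Qed.

Lemma half_sqrK {K : numFieldType} (a : K) :
  a != 0 -> 2^-1 * a ^+ 2 * (2 / a ^+ 2) = 1.
Proof. by move=> a0; field. Qed.

Lemma cvg_within_prod {T U V : Type} {F : set_system T} {FF : Filter F}
    {G : set_system U} {FG : Filter G} {H : set_system V} {FH : Filter H}
    (D : set (U * V)) (f : T -> U) (g : T -> V) :
  f @ F --> G -> g @ F --> H -> (\forall x \near F, D (f x, g x)) ->
  (fun x => (f x, g x)) @ F --> within D (filter_prod G H).
Proof.
move=> fG gH fgD P PD.
have : \forall x \near F, D (f x, g x) -> P (f x, g x).
  exact: cvg_pair fG gH _ PD.
by apply: filterS2 fgD => x Dx; apply.
Qed.

(** * Transfer between Gamma and Omega through the local inverse [zhat] of [B] *)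

Section Chart.
Context {R : realType} {n m l : nat}.
Variables (B : 'rV[R]_n -> 'rV[R]_m) (G : 'rV[R]_n -> 'rV[R]_l).
Variables (Gamma : set 'rV[R]_n) (Omega : set 'rV[R]_m).
Variables (z : 'rV[R]_n) (zhat : 'rV[R]_m -> 'rV[R]_n).
Variables (p : nat) (N : 'M[R]_(l, p)).
Variables (E : 'M[R]_(m, n)) (F : 'M[R]_(p, n)).
Local Notation A := ('J B z).
Local Notation H := ('J G z *m N).
Local Notation om := (B z).
Hypotheses (B_C2 : C2 B) (G_C2 : C2 G).
Hypothesis zhat_om : zhat om = z.
Hypothesis B_Gamma : forall y, Gamma y -> Omega (B y).
Hypothesis zhatP :
  \forall o \near om, Omega o -> Gamma (zhat o) /\ B (zhat o) = o.
Hypothesis zhat_lip :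
  exists c, \forall o \near om, Omega o -> `|zhat o - z| <= c * `|o - om|.
Hypothesis GammaN : \forall y \near z, Gamma y -> (G y - G z) *m N = 0.
Hypothesis AEHF : A *m E + H *m F = 1%:M.

Lemma rowAEHF (v : 'rV[R]_n) : v = v *m A *m E + v *m H *m F.
Proof. by rewrite -!(mulmxA v) -mulmxDr AEHF mulmx1. Qed.

Lemma cvg_AH {T : Type} {S : set_system T} {SF : Filter S}
    (h : T -> 'rV[R]_n) (a : 'rV[R]_m) (b : 'rV[R]_p) :
  (fun x => h x *m A) @ S --> a -> (fun x => h x *m H) @ S --> b ->
  h @ S --> a *m E + b *m F.
Proof.
move=> ha hb.
have -> : h = (fun x => h x *m A *m E + h x *m H *m F).
  by apply/funext => x; exact: rowAEHF.
by apply: cvgD; exact: cvg_mulmx.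
Qed.

(** * Difference quotients of [zhat] along a filter, covering both sequences and the pairs of the
    subderivative *)

Section Along.
Context {T : Type} {S : set_system T} {SF : Filter S}.
Variables (t : T -> R).
Hypotheses (t0 : t @ S --> 0) (t_gt0 : \forall x \near S, 0 < t x).

(** The Lipschitz bound makes the quotients bounded, so [B] and [G] can be expanded to first order
    at z + t h. There [B] equals om + t eta_, which gives the first limit, and the increment of [G]
    is killed by [N], which gives the second. *)
Lemma chart_diff (eta_ : T -> 'rV[R]_m) (eta : 'rV[R]_m) :
  eta_ @ S --> eta -> (\forall x \near S, Omega (om + t x *: eta_ x)) ->
  let h := fun x => (t x)^-1 *: (zhat (om + t x *: eta_ x) - z) in
  (fun x => h x *m A) @ S --> eta /\ (fun x => h x *m H) @ S --> (0 : 'rV[R]_p).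
Proof.
move=> eta_cvg Omx h.
have [c lip] := zhat_lip; have [[dB _] _] := B_C2; have [[dG _] _] := G_C2.
have om_cvg : (fun x => om + t x *: eta_ x) @ S --> om.
  exact: (cvg_addZ _ _ _ _ t0 eta_cvg).
have lipx : \forall x \near S, Omega (om + t x *: eta_ x) ->
    `|zhat (om + t x *: eta_ x) - z| <= c * `|om + t x *: eta_ x - om|.
  exact: om_cvg _ lip.
have zPx : \forall x \near S, Omega (om + t x *: eta_ x) ->
    Gamma (zhat (om + t x *: eta_ x)) /\
    B (zhat (om + t x *: eta_ x)) = om + t x *: eta_ x.
  exact: om_cvg _ zhatP.
have eta_bd : \forall x \near S, `|eta_ x| <= `|eta| + 1.
  by apply: (cvgr_norm_le _ eta_cvg); rewrite ltrDl.
have h_bd : \forall x \near S, `|h x| <= `|c| * (`|eta| + 1).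
  apply: filterS2 eta_bd _; last exact: filterI lipx (filterI Omx t_gt0).
  move=> x ex [lx [Ox tx]]; rewrite normrZ gtr0_norm ?invr_gt0 //.
  rewrite ler_pdivrMl // (le_trans (lx Ox)) // addrAC subrr add0r normrZ.
  rewrite gtr0_norm // mulrCA ler_pM2l //.
  by rewrite (le_trans (ler_wpM2r _ (ler_norm c))) // ler_wpM2l.
have hE : \forall x \near S, z + t x *: h x = zhat (om + t x *: eta_ x).
  apply: filterS t_gt0 => x tx.
  by rewrite scalerA divff ?gt_eqF // scale1r subrKC.
have z_cvg : (fun x => z + t x *: h x) @ S --> z.
  rewrite -[X in _ --> X]addr0; apply: cvgD; first exact: cvg_cst.
  exact: cvg_scale0_bounded h_bd.
have GNx : \forall x \near S, Gamma (z + t x *: h x) ->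
    (G (z + t x *: h x) - G z) *m N = 0.
  exact: z_cvg _ GammaN.
split.
- have hB := @taylor1_cvg _ _ _ SF _ _ B z t h _ (dB z) t0 t_gt0 h_bd.
  have := @cvgB _ _ _ _ SF _ _ _ _ eta_cvg hB.
  rewrite subr0; apply: cvg_near_eq.
  apply: filterS3 (filterI zPx Omx) t_gt0 hE => x [zx Ox] tx hx.
  have [_ Bx] := zx Ox; rewrite !fctE hx Bx addrAC subrr add0r.
  by rewrite scalerA mulVf ?gt_eqF // scale1r opprB subrKC.
- have hG := @taylor1_cvg _ _ _ SF _ _ G z t h _ (dG z) t0 t_gt0 h_bd.
  have := @cvgN _ _ _ _ SF _ _ (@cvg_mulmx _ _ _ SF _ _ N _ _ hG).
  rewrite mul0mx oppr0; apply: cvg_near_eq.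
  apply: filterS3 (filterI zPx Omx) GNx hE => x [zx Ox] Gx hx.
  have [Gax _] := zx Ox; rewrite !fctE mulmxBl -scalemxAl Gx ?hx //.
  by rewrite scaler0 sub0r opprK mulmxA.
Qed.

(** The first order quotients [h] tend to [w], so the second order expansions of [B] and [G] hold
    along z + t h. Their first order terms at [w] cancel by [wA] and [wH], leaving the quadratic
    ones. *)
Lemma chart_diff2 (zeta_ : T -> 'rV[R]_m) (zeta eta : 'rV[R]_m) (w : 'rV[R]_n) :
  w *m A = eta -> w *m H = 0 -> zeta_ @ S --> zeta ->
  (\forall x \near S, Omega (om + t x *: eta + (2^-1 * t x ^+ 2) *: zeta_ x)) ->
  let v := fun x => (2 / t x ^+ 2) *:
    (zhat (om + t x *: eta + (2^-1 * t x ^+ 2) *: zeta_ x) - z - t x *: w) in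
  (fun x => v x *m A) @ S --> zeta - quad2 B z w /\
  (fun x => v x *m H) @ S --> - (quad2 G z w *m N).
Proof.
move=> wA wH zeta_cvg Omx v.
pose o x := om + t x *: eta + (2^-1 * t x ^+ 2) *: zeta_ x.
pose eta_ x := eta + (2^-1 * t x) *: zeta_ x.
have oE x : o x = om + t x *: eta_ x.
  exact: parabolaE.
have eta_cvg : eta_ @ S --> eta by exact: (cvg_addZ_half _ _ _ _ t0 zeta_cvg).
have Omx' : \forall x \near S, Omega (om + t x *: eta_ x).
  by apply: filterS Omx => x; rewrite -oE.
have [hA hH] := chart_diff _ _ eta_cvg Omx'.
(* The limit eta E + 0 F is w A E + w H F, which is [w]. *)
have := @cvg_AH _ _ SF _ _ _ hA hH; rewrite -wH -{1}wA -rowAEHF.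
set h := (fun x => _) => h_cvg.
have zPx : \forall x \near S, Omega (om + t x *: eta_ x) ->
    Gamma (zhat (om + t x *: eta_ x)) /\
    B (zhat (om + t x *: eta_ x)) = om + t x *: eta_ x.
  exact: (cvg_addZ om _ _ _ t0 eta_cvg) _ zhatP.
have GNx : \forall x \near S, Gamma (z + t x *: h x) ->
    (G (z + t x *: h x) - G z) *m N = 0.
  exact: (cvg_addZ z t h w t0 h_cvg) _ GammaN.
have factsx : \forall x \near S, [/\ t x *: h x = zhat (o x) - z,
    t x != 0, B (z + t x *: h x) = om + t x *: eta_ x &
    (G (z + t x *: h x) - G z) *m N = 0].
  apply: filterS3 (filterI zPx Omx') t_gt0 GNx => x [zx Ox] tx Gx.
  have thx : t x *: h x = zhat (o x) - z.
    by rewrite scalerA divff ?gt_eqF // scale1r oE.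
  have [Gax Bx] := zx Ox; rewrite thx subrKC oE in Gx *.
  by split; rewrite ?Bx ?Gx // gt_eqF.
clearbody h; have hB := @taylor2_cvg _ _ _ SF _ _ B z t h w B_C2 t0 t_gt0 h_cvg.
have hG := @taylor2_cvg _ _ _ SF _ _ G z t h w G_C2 t0 t_gt0 h_cvg.
split.
- have := @cvgB _ _ _ _ SF _ _ _ _ zeta_cvg hB; apply: cvg_near_eq.
  apply: filterS factsx => x [thx tx Bx _]; rewrite !fctE Bx /v -/(o x) -thx.
  rewrite -!scalemxAl mulmxBl -!scalemxAl wA.
  rewrite [om + _]addrC addrK /eta_; move: (t x *: (h x *m A)) => X.
  have {1}-> : zeta_ x = (2 / t x ^+ 2) *: (t x *: ((2^-1 * t x) *: zeta_ x)).
    rewrite !scalerA (_ : _ * _ = 1) ?scale1r //; field.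
    exact: tx.
  rewrite -scalerBr; congr (_ *: _).
  by rewrite scalerDr opprB addrCA opprD [- _ - _]addrC addNKr.
- have := @cvgN _ _ _ _ SF _ _ (@cvg_mulmx _ _ _ SF _ _ N _ _ hG).
  apply: cvg_near_eq.
  apply: filterS factsx => x [thx tx _ Gx]; rewrite !fctE /v -/(o x) -thx.
  rewrite -!scalemxAl mulmxBl Gx sub0r scalerN opprK mulmxBl -!scalemxAl.
  by rewrite wH scaler0 subr0 mulmxA.
Qed.

Lemma chart_quotient_cvg (eta_ : T -> 'rV[R]_m) (eta : 'rV[R]_m) :
  eta_ @ S --> eta -> (\forall x \near S, Omega (om + t x *: eta_ x)) ->
  (fun x => (t x)^-1 *: (zhat (om + t x *: eta_ x) - z)) @ S --> eta *m E.
Proof.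
move=> eta_cvg Omx; have [hA hH] := chart_diff _ _ eta_cvg Omx.
by rewrite -[X in _ --> X]addr0 -(mul0mx _ F); exact: cvg_AH.
Qed.

End Along.

(** [eta *m E] is the limit of the quotients of [zhat], whose products with A and H have the limits
    [eta] and 0. *)
Lemma chart_tangent eta : tangent Omega om eta ->
  eta *m E *m A = eta /\ eta *m E *m H = 0.
Proof.
move=> [t [eta_ [[tgt0 t0] eta_cvg Omk]]].
have tgt0' : \forall k \near \oo, 0 < t k by exact: nearW.
have [hA hH] := chart_diff t t0 tgt0' eta_ eta eta_cvg (nearW _ Omk).
have h_cvg : (fun k => (t k)^-1 *: (zhat (om + t k *: eta_ k) - z)) @ \oo -->
    eta *m E by apply: chart_quotient_cvg => //; exact: nearW.
split.
  by apply: cvg_seq_unique hA; exact: cvg_mulmx.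
by apply: cvg_seq_unique hH; exact: cvg_mulmx.
Qed.

Lemma chart_dir_deriv eta :
  tangent Omega om eta -> dir_deriv Omega zhat om eta = eta *m E.
Proof.
move=> eta_tan; rewrite /dir_deriv zhat_om; apply: get_unique => /=.
  move=> t eta_ [tgt0 t0] eta_cvg Omk.
  by apply: chart_quotient_cvg => //; exact: nearW.
(* Uniqueness of the value of [get] requires at least one admissible sequence, which tangency of
   [eta] provides. *)
move=> w; have [t [eta_ [[tgt0 t0] eta_cvg Omk]]] := eta_tan.
move=> /(_ _ _ (conj tgt0 t0) eta_cvg Omk) w_cvg.
apply: (cvg_seq_unique _ _ _ w_cvg).
by apply: chart_quotient_cvg => //; exact: nearW.
Qed.

Section SecondOrder.
Variables (eta : 'rV[R]_m) (w : 'rV[R]_n).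
Hypotheses (wA : w *m A = eta) (wH : w *m H = 0).

(** Along the curve in Gamma the increment of [G] is killed by [N], so its second order expansion
    determines the H-part of [v]. The tangent set thus lies in a translate of the kernel of H. *)
Lemma tangent2_kernel v : tangent2 Gamma z w v ->
  v *m H = - (quad2 G z w *m N).
Proof.
move=> [t [v_ [[tgt0 t0] v_cvg Gk]]].
have h_cvg : (fun k => w + (2^-1 * t k) *: v_ k) @ \oo --> w.
  exact: cvg_addZ_half t0 v_cvg.
have tgt0' : \forall k \near \oo, 0 < t k by exact: nearW.
have hG := @taylor2_cvg R nat \oo eventually_filter
  _ _ G z t _ w G_C2 t0 tgt0' h_cvg.
have GNk : \forall k \near \oo, Gamma (z + t k *: (w + (2^-1 * t k) *: v_ k)) ->
    (G (z + t k *: (w + (2^-1 * t k) *: v_ k)) - G z) *m N = 0.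
  exact: (cvg_addZ z t _ w t0 h_cvg) _ GammaN.
have vH_cvg : (fun k => v_ k *m H) @ \oo --> v *m H by exact: cvg_mulmx.
apply: (cvg_seq_unique _ _ _ vH_cvg).
have := @cvgN _ _ _ _ eventually_filter _ _
  (@cvg_mulmx _ _ _ eventually_filter _ _ N _ _ hG).
apply: cvg_near_eq.
apply: filterS GNk => k GNk; rewrite !fctE -!scalemxAl mulmxBl GNk; last first.
  by rewrite -parabolaE.
rewrite sub0r scalerN opprK -scalemxAl -mulmxA mulmxDl wH add0r -scalemxAl.
rewrite !scalerA (_ : _ * _ = 1) ?scale1r //; field.
by rewrite gt_eqF.
Qed.

Lemma tangent2_left_inverse u v :
  tangent2 Gamma z w u -> tangent2 Gamma z w v -> (u - v) *m A *m E = u - v.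
Proof.
move=> /tangent2_kernel uH /tangent2_kernel vH.
by rewrite [RHS]rowAEHF [(u - v) *m H]mulmxBl uH vH subrr mul0mx addr0.
Qed.

(** Curves in Omega are lifted by [zhat], with [chart_diff2] and [cvg_AH] giving convergence of the
    second order quotients; curves in Gamma are mapped by [B] and expanded. *)
Lemma tangent2_image :
  tangent2 Omega om eta = [set v *m A + quad2 B z w | v in tangent2 Gamma z w].
Proof.
apply/seteqP; split=> [zeta|_ [v [t [v_ [[tgt0 t0] v_cvg Gk]]] <-]].
  move=> [t [zeta_ [[tgt0 t0] zeta_cvg Omk]]].
  have tgt0' : \forall k \near \oo, 0 < t k by exact: nearW.
  have [vA vH] :=
    chart_diff2 t t0 tgt0' zeta_ zeta eta w wA wH zeta_cvg (nearW _ Omk).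
  set v := (zeta - quad2 B z w) *m E + - (quad2 G z w *m N) *m F.
  have v_cvg := @cvg_AH _ _ eventually_filter _ _ _ vA vH.
  exists v; last first.
    suff -> : v *m A = zeta - quad2 B z w by rewrite subrK.
    by apply: cvg_seq_unique vA; exact: cvg_mulmx.
  pose o k := om + t k *: eta + (2^-1 * t k ^+ 2) *: zeta_ k.
  have o_cvg : o @ \oo --> om.
    rewrite (_ : o = (fun k => om + t k *: (eta + (2^-1 * t k) *: zeta_ k))).
      by apply: (cvg_addZ _ _ _ eta) => //; exact: cvg_addZ_half zeta_cvg.
    by apply/funext => k; exact: parabolaE.
  have [K _ KP] : \forall k \near \oo, Gamma (zhat (o k)).
    have : \forall k \near \oo, Omega (o k) ->
        Gamma (zhat (o k)) /\ B (zhat (o k)) = o k by exact: o_cvg _ zhatP.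
    by apply: filterS => k /(_ (Omk k))[].
  pose v_ k := (2 / t k ^+ 2) *: (zhat (o k) - z - t k *: w).
  (* The lifted points are known to lie in Gamma only from index [K] on, whereas the definition asks
     for all indices. *)
  exists (fun k => t (k + K)%N), (fun k => v_ (k + K)%N).
  split=> [|| k]; [split=> // | |].
  - by rewrite (cvg_shiftn K t).
  - by rewrite (cvg_shiftn K v_).
  - rewrite scalerA half_sqrK ?gt_eqF // scale1r -[_ - z - _]addrA -opprD.
    rewrite subrKC.
    by apply: KP; rewrite /= leq_addl.
have h_cvg : (fun k => w + (2^-1 * t k) *: v_ k) @ \oo --> w.
  exact: cvg_addZ_half t0 v_cvg.
have tgt0' : \forall k \near \oo, 0 < t k by exact: nearW.
have hB := @taylor2_cvg R nat \oo eventually_filter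
  _ _ B z t _ w B_C2 t0 tgt0' h_cvg.
(* The second order coefficients are solved for, so that the curve is exactly the image under
   [B]. *)
exists t, (fun k => (2 / t k ^+ 2) *:
  (B (z + t k *: w + (2^-1 * t k ^+ 2) *: v_ k) - om - t k *: eta)).
split=> [||k]; [by split| |]; last first.
  rewrite scalerA half_sqrK ?gt_eqF // scale1r -[_ - om - _]addrA -opprD subrKC.
  exact: B_Gamma.
have vA_cvg : (fun k => v_ k *m A) @ \oo --> v *m A by exact: cvg_mulmx.
have := @cvgD _ _ _ _ eventually_filter _ _ _ _ vA_cvg hB; apply: cvg_near_eq.
apply: nearW => k; rewrite !fctE -parabolaE.
have {1}-> : v_ k *m A = (2 / t k ^+ 2) *: ((2^-1 * t k ^+ 2) *: (v_ k *m A)).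
  by rewrite scalerA [_ / _ * _]mulrC half_sqrK ?gt_eqF // scale1r.
rewrite -scalerDr parabolaE; congr (_ *: _); move: (B _ - om) => X.
rewrite addrCA; congr (_ + _).
rewrite -scalemxAl mulmxDl -scalemxAl wA scalerDr scalerA opprD addrCA.
rewrite (_ : t k * (2^-1 * t k) = 2^-1 * t k ^+ 2) ?subrr ?addr0 //; ring.
Qed.

End SecondOrder.

(** The pairs (t, u') on the two sides correspond through the difference quotients of [B] ([phi])
    and of [zhat] ([psi]). The two integrands differ by the second order remainder [r] of [B], whose
    limit is the curvature term. *)
Lemma chart_subderiv2 eta w oms : w = eta *m E -> w *m A = eta ->
  subderiv2 Omega om oms eta =
  (subderiv2 Gamma z (jacT_app B z oms) w - (dot oms (quad2 B z w))%:E)%E.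
Proof.
move=> wE wA; rewrite /subderiv2.
set FG := within _ (filter_prod _ (nbhs w)).
set FO := within _ (filter_prod _ (nbhs eta)).
have FGF : Filter FG by apply: within_filter.
have FOF : Filter FO by apply: within_filter.
pose phi (x : R * 'rV[R]_n) : R * 'rV[R]_m :=
  (x.1, x.1^-1 *: (B (z + x.1 *: x.2) - om)).
pose psi (x : R * 'rV[R]_m) : R * 'rV[R]_n :=
  (x.1, x.1^-1 *: (zhat (om + x.1 *: x.2) - z)).
have G1 : (fun x : R * 'rV[R]_n => x.1) @ FG --> (0 : R)^'+.
  by apply: cvg_within_filter; exact: cvg_fst.
have O1 : (fun x : R * 'rV[R]_m => x.1) @ FO --> (0 : R)^'+.
  by apply: cvg_within_filter; exact: cvg_fst.
have G2 : (fun x : R * 'rV[R]_n => x.2) @ FG --> w.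
  by apply: cvg_within_filter; exact: cvg_snd.
have O2 : (fun x : R * 'rV[R]_m => x.2) @ FO --> eta.
  by apply: cvg_within_filter; exact: cvg_snd.
have G1gt : \forall x \near FG, 0 < x.1 by exact: G1 _ (nbhs_right_gt 0).
have O1gt : \forall x \near FO, 0 < x.1 by exact: O1 _ (nbhs_right_gt 0).
have G10 : (fun x : R * 'rV[R]_n => x.1) @ FG --> 0.
  by apply: cvg_trans G1 _; exact: cvg_within.
have O10 : (fun x : R * 'rV[R]_m => x.1) @ FO --> 0.
  by apply: cvg_trans O1 _; exact: cvg_within.
have GG : \forall x \near FG, Gamma (z + x.1 *: x.2).
  by rewrite near_withinE; exact: filterE.
have OO : \forall x \near FO, Omega (om + x.1 *: x.2).
  by rewrite near_withinE; exact: filterE.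
have phi2 : (fun x => (phi x).2) @ FG --> eta.
  have G2bd : \forall x \near FG, `|x.2| <= `|w| + 1.
    by apply: (cvgr_norm_le _ G2); rewrite ltrDl.
  have [[dB _] _] := B_C2.
  have wA_cvg : (fun x : R * 'rV[R]_n => x.2 *m A) @ FG --> eta.
    by rewrite -wA; exact: cvg_mulmx.
  exact: cvg_sub0 (taylor1_cvg _ _ B z _ _ _ (dB z) G10 G1gt G2bd) wA_cvg.
have psi2 : (fun x => (psi x).2) @ FO --> w.
  by rewrite wE; exact: chart_quotient_cvg.
have zP : \forall x \near FO, Gamma (zhat (om + x.1 *: x.2)) /\
    B (zhat (om + x.1 *: x.2)) = om + x.1 *: x.2.
  have : \forall x \near FO, Omega (om + x.1 *: x.2) ->
      Gamma (zhat (om + x.1 *: x.2)) /\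
      B (zhat (om + x.1 *: x.2)) = om + x.1 *: x.2.
    exact: (cvg_addZ om _ _ _ O10 O2) _ zhatP.
  by apply: filterS2 OO => x Ox; apply.
pose r (x : R * 'rV[R]_n) := - dot oms ((2 / x.1 ^+ 2) *:
  (B (z + x.1 *: x.2) - om - (x.1 *: x.2) *m A)).
rewrite -EFinN.
apply: (limf_einf_change_var _ _ FG FO phi psi _ _ r).
- apply: cvg_within_prod => //; apply: filterS2 GG G1gt => x Gx x0 /=.
  by rewrite scalerA divff ?gt_eqF // scale1r subrKC; exact: B_Gamma.
- apply: cvg_within_prod => //; apply: filterS2 zP O1gt => x [Gx _] x0 /=.
  by rewrite scalerA divff ?gt_eqF // scale1r subrKC.
- apply: filterS2 zP O1gt => -[s y] [_ Bx] x0 /=; rewrite /phi /psi /= in Bx *.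
  rewrite scalerA divff ?gt_eqF // scale1r subrKC Bx addrC addKr.
  by rewrite scalerA mulVf ?gt_eqF // scale1r.
- apply: cvgN; apply: cvg_dot; first exact: cvg_cst.
  exact: taylor2_cvg.
- apply: filterS G1gt => x x0; rewrite -EFinD; congr (_%:E).
  rewrite /jacT_app dot_mulmx /r /phi /=; move: (B _ - om) => X.
  rewrite -scalemxAl !dotZr dotBr dotZr; field.
  by rewrite gt_eqF.
Qed.

Lemma chart_second_order eta oms : tangent Omega om eta ->
  let w := dir_deriv Omega zhat om eta in
  [/\ subderiv2 Omega om oms eta =
        (subderiv2 Gamma z (jacT_app B z oms) w
           - (dot oms (quad2 B z w))%:E)%E,
      support_fun (tangent2 Omega om eta) oms =
        (support_fun (tangent2 Gamma z w) (jacT_app B z oms)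
           + (dot oms (quad2 B z w))%:E)%E
    & lower_support_fun (tangent2 Omega om eta) oms =
        (lower_support_fun (tangent2 Gamma z w) (jacT_app B z oms)
           + (dot oms (quad2 B z w))%:E)%E].
Proof.
move=> eta_tan w; have wE : w = eta *m E by exact: chart_dir_deriv.
have [wA wH] := chart_tangent _ eta_tan; rewrite -wE in wA wH.
rewrite (tangent2_image _ _ wA wH); split.
- exact: chart_subderiv2.
- exact: support_fun_affine_image.
- apply: lower_support_fun_affine_image => u v; exact: tangent2_left_inverse.
Qed.

End Chart.

Theorem theorem3p7 (R : realType) (n m l : nat)
  (B : 'rV[R]_n -> 'rV[R]_m) (G : 'rV[R]_n -> 'rV[R]_l) (D : set 'rV[R]_l)
  (Gamma : set 'rV[R]_n) (Omega : set 'rV[R]_m)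
  (B_C2 : C2 B) (G_C2 : C2 G) (D_poly : polyhedral D)
  (GammaE : Gamma = G @^-1` D) (OmegaE : Omega = B @` Gamma)
  (ombar : 'rV[R]_m) (zbar : 'rV[R]_n)
  (ombar_Omega : Omega ombar) (zbar_Sigma : Sigma B Gamma Omega ombar zbar)
  (inj_L : forall w, jac_app B zbar w = 0 -> L_space G D zbar w -> w = 0)
  (gammaB : R) (gammaB_gt0 : 0 < gammaB)
  (Wt : set 'rV[R]_n) (Wt_open : open Wt) (Wt_zbar : Wt zbar)
  (min_gt : (gammaB%:E < ereal_inf [set (enorm (jac_app B zbar w))%:E
               | w in [set w | L_space G D zbar w /\ enorm w = 1%R]])%E)
  (jac_ge : forall z, (Gamma `&` Wt) z -> forall w, L_space G D z w ->
               gammaB * enorm w <= enorm (jac_app B z w))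
  (B_ge : forall z1 z2, (Gamma `&` Wt) z1 -> (Gamma `&` Wt) z2 ->
               gammaB * enorm (z1 - z2) <= enorm (B z1 - B z2))
  (O : set 'rV[R]_m) (O_open : open O) (O_ombar : O ombar)
  (W : set 'rV[R]_n) (W_open : open W) (W_zbar : W zbar) (W_sub : W `<=` Wt)
  (zhat : 'rV[R]_m -> 'rV[R]_n)
  (zhat_bij : set_bij (Omega `&` O) (Gamma `&` W) zhat)
  (zhat_lip : forall om1 om2, (Omega `&` O) om1 -> (Omega `&` O) om2 ->
               enorm (zhat om1 - zhat om2) <= gammaB^-1 * enorm (om1 - om2))
  (zhatE : forall om, (Omega `&` O) om ->
               (B @^-1` [set om] `&` Gamma) `&` W = [set zhat om]) :
  forall om eta oms : 'rV[R]_m,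
    (Omega `&` O) om -> tangent Omega om eta ->
    let z := zhat om in
    let w := dir_deriv Omega zhat om eta in
    [/\ subderiv2 Omega om oms eta =
          (subderiv2 Gamma z (jacT_app B z oms) w
             - (dot oms (quad2 B z w))%:E)%E,
        support_fun (tangent2 Omega om eta) oms =
          (support_fun (tangent2 Gamma z w) (jacT_app B z oms)
             + (dot oms (quad2 B z w))%:E)%E
      & lower_support_fun (tangent2 Omega om eta) oms =
          (lower_support_fun (tangent2 Gamma z w) (jacT_app B z oms)
             + (dot oms (quad2 B z w))%:E)%E].
Proof.
move=> om eta oms Om_om eta_tan.
have oE o : (Omega `&` O) o -> [/\ Gamma (zhat o), B (zhat o) = o & W (zhat o)].
  by move=> /zhatE oE; have : [set zhat o] (zhat o) by []; rewrite -oE => -[[]].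
have [z zE] : exists z, zhat om = z by exists (zhat om).
have [Gz Bz Wz] := oE om Om_om; rewrite zE in Gz Bz Wz *.
have {zE} zhat_om : zhat (B z) = z by rewrite Bz.
subst om.
(* With this [N], membership of w in L_z means that its product with ['J G z *m N] vanishes. *)
have [N NP] := linear_span_kernel
  [set v | exists x y, [/\ tangent D (G z) x, tangent D (G z) y & v = x - y]].
have Dz : D (G z) by move: Gz; rewrite GammaE.
have [[dB _] _] := B_C2; have [[dG _] _] := G_C2.
have GammaN : \forall y \near z, Gamma y -> (G y - G z) *m N = 0.
  have Dnear : \forall y \near z, D (G y) -> tangent D (G z) (G y - G z).
    have := polyhedral_tangent_near _ (G z) D_poly.
    exact: (differentiable_continuous (dG z)) _.
  apply: filterS Dnear => y; rewrite GammaE => yT Dy; apply/NP.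
  (* The increment is itself a tangent vector, hence its difference with the tangent vector 0 is in
     the spanning set. *)
  exists [:: G y - G z]; last by rewrite memv_span // mem_head.
  move=> x; rewrite inE => /eqP ->; exists (G y - G z), 0.
  by split; [exact: yT|exact: tangent0|rewrite subr0].
(* A common kernel vector lies in L_z, and [jac_ge] at [z] forces its norm to be 0. *)
have [E [F AEHF]] : exists E F, 'J B z *m E + 'J G z *m N *m F = 1%:M.
  apply: injective_left_inverse => w wA wH; apply: enorm_eq0.
  have Lw : L_space G D z w by apply/NP; rewrite /jac_app -mulmxA.
  have := jac_ge z (conj Gz (W_sub _ Wz)) w Lw.
  by rewrite /jac_app wA enorm0 pmulr_rle0.
have nearO : \forall o \near B z, O o.
  by apply: open_nbhs_nbhs; split=> //; case: Om_om.
apply: (chart_second_order B G Gamma Omega z zhat _ N E F) => //.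
- by move=> y Gy; rewrite OmegaE; exists y.
- by apply: filterS nearO => o Oo Om_o; have [] := oE o (conj Om_o Oo).
(* The factor [m] converts the Euclidean Lipschitz bound to the max norm. *)
- exists (gammaB^-1 * m%:R); apply: filterS nearO => o Oo Om_o.
  rewrite -[in zhat o - z]zhat_om (le_trans (mx_norm_le_enorm _ _)) //.
  rewrite (le_trans (zhat_lip _ _ (conj Om_o Oo) Om_om)) // -mulrA.
  by rewrite ler_wpM2l ?enorm_le_mx_norm // invr_ge0 ltW.
Qed.
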